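(* Let $X$ and $Y$ be ordered vector spaces. (i) If $X$ has a generating cone (i.e. $X=X_+-X_+$), then every collectively ru-continuous set ${\cal T}\subseteq{\cal L}(X,Y)$ is collectively order bounded. (ii) If $Y$ has a generating cone (i.e. $Y=Y_+-Y_+$), then every collectively order bounded set ${\cal T}\subseteq{\cal L}(X,Y)$ is collectively ru-continuous.
   Context: All vector spaces are real and operators are linear; ${\cal L}(X,Y)$ is the space of all linear operators from $X$ to $Y$. An ordered vector space $X$ has positive cone $X_+$ (with $X_+\cap(-X_+)=\{0\}$); order intervals are $[a,b]=\{x: a\le x\le b\}$. Relative uniform convergence: a net $(x_\alpha)$ in $X$ ru-converges to $x$ if, for some $u\in X_+$, there is an increasing sequence $(\alpha_n)$ of indices with $-\frac1n u\le x_\alpha-x\le\frac1n u$ for all $\alpha\ge\alpha_n$. Collective ru-convergence: a family $\{(x^b_\alpha)_{\alpha\in A}\}_{b\in B}$ of nets indexed by the same directed set $A$ collectively ru-converges to $0$ if, for some $u\in X_+$, there is an increasing sequence $(\alpha_n)$ of indices with $\pm x^b_\alpha\le\frac1n u$ for all $\alpha\ge\alpha_n$ and all $b\in B$. A set ${\cal T}\subseteq{\cal L}(X,Y)$ is collectively ru-continuous if, whenever a net $(x_\alpha)$ ru-converges to $0$ in $X$, the family $\{(Tx_\alpha)_\alpha\}_{T\in{\cal T}}$ collectively ru-converges to $0$ in $Y$. A set ${\cal T}$ is collectively order bounded if for every order interval $[a,b]$ in $X$ there is an order interval $[u,v]$ in $Y$ with $\bigcup_{T\in{\cal T}}T[a,b]\subseteq[u,v]$.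 *)

(* Defs.v *)
From HB Require Import structures.
From mathcomp Require Import all_boot all_order all_algebra.
From mathcomp Require Import boolp classical_sets reals.

Set Implicit Arguments.
Unset Strict Implicit.
Unset Printing Implicit Defensive.

Import Order.TTheory GRing.Theory Num.Theory.
Local Open Scope classical_set_scope.
Local Open Scope ring_scope.

(* The order is only partial and is not assumed Archimedean.  Antisymmetry of
   the order is the condition X_+ `&` (- X_+) = {0} on the positive cone. *)
HB.mixin Record isOrderedVector (R : realType) X
    of Num.POrderedZmodule X & GRing.Lmodule R X := {
  ov_leD2r : forall z x y : X, x <= y -> x + z <= y + z ;
  ov_ler_wpZ2l : forall (c : R) (x y : X), 0 <= c -> x <= y -> c *: x <= c *: y
}.

#[short(type="orderedVectorType")]
HB.structure Definition OrderedVector (R : realType) :=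
  { X of isOrderedVector R X & Num.POrderedZmodule X & GRing.Lmodule R X }.

Section OrderedVectorSpaces.
Context {R : realType}.

Definition positive_cone (X : orderedVectorType R) : set X :=
  [set x | 0 <= x].
Arguments positive_cone : clear implicits.

Definition generating_cone (X : orderedVectorType R) : Prop :=
  [set y - z | y in positive_cone X & z in positive_cone X] = [set: X].

Definition order_interval (X : orderedVectorType R) (a b : X) : set X :=
  [set x | a <= x <= b].

End OrderedVectorSpaces.
Arguments positive_cone {R} X _.
Arguments generating_cone {R} X.

(* As usual for nets, antisymmetry is not required. *)
Definition directed_preorder (A : Type) (leA : A -> A -> Prop) : Prop :=
  [/\ inhabited A,
      forall i, leA i i,
      forall i j k, leA i j -> leA j k -> leA i k
    & forall i j, exists2 k, leA i k & leA j k].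

Definition increasing_indices (A : Type) (leA : A -> A -> Prop)
    (alpha : nat -> A) : Prop :=
  forall m n, (m <= n)%N -> leA (alpha m) (alpha n).

Section RuConvergence.
Context {R : realType}.

(* Indices start at 0, so the regulator 1/n becomes n.+1%:R^-1. *)
Definition ru_converges (X : orderedVectorType R) (A : Type)
    (leA : A -> A -> Prop) (x : A -> X) (l : X) : Prop :=
  exists2 u : X, positive_cone X u &
  exists2 alpha : nat -> A, increasing_indices leA alpha &
  forall (n : nat) (i : A), leA (alpha n) i ->
    - (n.+1%:R^-1 *: u) <= x i - l <= n.+1%:R^-1 *: u.

(* The family of nets is (x b)_{b in B}. *)
Definition collectively_ru_null (X : orderedVectorType R) (A : Type)
    (leA : A -> A -> Prop) (I : Type) (B : set I) (x : I -> A -> X) : Prop :=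
  exists2 u : X, positive_cone X u &
  exists2 alpha : nat -> A, increasing_indices leA alpha &
  forall (n : nat) (i : A) (b : I), leA (alpha n) i -> B b ->
    x b i <= n.+1%:R^-1 *: u /\ - x b i <= n.+1%:R^-1 *: u.

Definition collectively_ru_continuous (X Y : orderedVectorType R)
    (TT : set {linear X -> Y}) : Prop :=
  forall (A : Type) (leA : A -> A -> Prop), directed_preorder leA ->
  forall x : A -> X, ru_converges leA x 0 ->
    collectively_ru_null leA TT (fun (T : {linear X -> Y}) i => T (x i)).

Definition collectively_order_bounded (X Y : orderedVectorType R)
    (TT : set {linear X -> Y}) : Prop :=
  forall a b : X, exists u v : Y,
    \bigcup_(T in TT) [set T x | x in order_interval a b]
      `<=` order_interval u v.

End RuConvergence.

(* Main.v *)
(** For (i), an interval [-u, u] is turned into a net by the index set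
    nat x [-u, u], directed by its first component, with (n, z) sent to
    z / (n + 1).  It ru-converges to 0, and one regulator of the images under TT
    bounds a whole tail of them; scaling back bounds all T z at once.  For (ii),
    if all T send [-u, u] into [-w, w], then they send [-u/n, u/n] into
    [-w/n, w/n]. *)
Require Import Defs.
From mathcomp Require Import all_boot all_order all_algebra.
From mathcomp Require Import boolp classical_sets reals.

Set Implicit Arguments.
Unset Strict Implicit.
Unset Printing Implicit Defensive.

Import Order.TTheory GRing.Theory Num.Theory.
Local Open Scope classical_set_scope.
Local Open Scope ring_scope.

Section OrderedVectorTheory.
Context {R : realType} {X : orderedVectorType R}.
Implicit Types (x y u : X) (c : R).

Lemma ov_leN2 x y : x <= y -> - y <= - x.
Proof. by move=> /(ov_leD2r (- x - y)); rewrite addrA subrr add0r addrC subrK. Qed.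

Lemma ov_oppr_le0 u : 0 <= u -> - u <= 0.
Proof. by move=> /ov_leN2; rewrite oppr0. Qed.

Lemma ov_lerDl x u : 0 <= u -> x <= x + u.
Proof. by move=> /(ov_leD2r x); rewrite add0r addrC. Qed.

Lemma ov_scale_ge0 c u : 0 <= c -> 0 <= u -> 0 <= c *: u.
Proof. by move=> c0 /(ov_ler_wpZ2l c _ _ c0); rewrite scaler0. Qed.

Lemma ov_scale_interval c u x :
  0 <= c -> - u <= x <= u -> - (c *: u) <= c *: x <= c *: u.
Proof. by move=> c0 /andP[ux xu]; rewrite -scalerN !ov_ler_wpZ2l. Qed.

Lemma ov_ler_wpZ2r c d u : 0 <= u -> c <= d -> c *: u <= d *: u.
Proof.
move=> u0 cd; rewrite -[d](subrK c) addrC scalerDl.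
by apply/ov_lerDl/ov_scale_ge0; rewrite ?subr_ge0.
Qed.

Lemma generating_cone_majorant :
  generating_cone X -> forall x, exists2 y, 0 <= y & x <= y.
Proof.
move=> gX x; have : [set: X] x by [].
rewrite -gX => -[y y0] [z z0 <-]; exists y => //.
by rewrite -[leRHS](subrK z); apply: ov_lerDl.
Qed.

(** Positive majorants [y] of [- a] and [z] of [b] add up to a common majorant of both, so
    [u := y + z] gives [- u <= a] and [b <= u]. *)
Lemma generating_cone_sym_interval :
  generating_cone X ->
  forall a b, exists2 u : X, 0 <= u &
    order_interval a b `<=` order_interval (- u) u.
Proof.
move=> gX a b.
have [y y0 aley] := generating_cone_majorant gX (- a).
have [z z0 blez] := generating_cone_majorant gX b.
exists (y + z) => [|x /= /andP[ax xb]]; first exact: le_trans (ov_lerDl _ z0).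
apply/andP; split.
  apply: le_trans ax; rewrite -[leRHS]opprK; apply: ov_leN2.
  exact: le_trans aley (ov_lerDl _ z0).
by apply: le_trans xb (le_trans blez _); rewrite addrC; apply: ov_lerDl.
Qed.

Definition interval_index (u : X) : Type := (nat * {z : X | - u <= z <= u})%type.

(** Points at the same level precede each other, so the tail above an index of level m contains
    [(m, z)] for every [z] in [-u, u]. *)
Definition interval_index_le u (i j : interval_index u) : Prop :=
  (i.1 <= j.1)%N.

Definition interval_net u (i : interval_index u) : X :=
  i.1.+1%:R^-1 *: sval i.2.

Lemma zero_in_sym_interval u : 0 <= u -> - u <= 0 <= u.
Proof. by move=> u0; rewrite u0 ov_oppr_le0. Qed.

Lemma interval_index_directed u :
  0 <= u -> directed_preorder (@interval_index_le u).
Proof.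
move=> u0; split.
- by constructor; exact: (0%N, exist _ 0 (zero_in_sym_interval u0)).
- by move=> i; apply: leqnn.
- by move=> i j k; apply: leq_trans.
- move=> i j; exists (maxn i.1 j.1, i.2).
    exact: leq_maxl.
  exact: leq_maxr.
Qed.

Lemma interval_net_ru_null u :
  0 <= u -> ru_converges (@interval_index_le u) (@interval_net u) 0.
Proof.
move=> u0; exists u => //.
(* The order sees only the level [n]; the point 0 merely fills the second component. *)
exists (fun n => (n, exist _ 0 (zero_in_sym_interval u0))) => // n [m [z zu]].
rewrite /interval_index_le /interval_net /= subr0 => nm.
have le_mn : (m.+1%:R^-1 : R) *: u <= n.+1%:R^-1 *: u.
  by apply: ov_ler_wpZ2r => //; rewrite lef_pV2 ?posrE ?ltr0n// ler_nat.
have inv_ge0 : 0 <= m.+1%:R^-1 :> R by rewrite invr_ge0 ler0n.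
have /andP[lo hi] := ov_scale_interval inv_ge0 zu.
by rewrite (le_trans hi le_mn) (le_trans (ov_leN2 le_mn) lo).
Qed.

End OrderedVectorTheory.

Section CollectiveBoundedness.
Context {R : realType} {X Y : orderedVectorType R}.
Variable TT : set {linear X -> Y}.

Lemma ru_continuous_order_bounded :
  generating_cone X ->
  collectively_ru_continuous TT -> collectively_order_bounded TT.
Proof.
move=> gX cT a b.
have [u u0 abu] := generating_cone_sym_interval gX a b.
have [w _ [alpha _ bnd]] :=
  cT _ _ (interval_index_directed u0) _ (interval_net_ru_null u0).
(* The tail at [n = 0], where the regulator has coefficient 1, is enough: every [(m, z)] lies in it,
   so all [T z / (m + 1)] are in [-w, w]. Multiplying by [m + 1] gives a bound that depends on
   neither [T] nor [z]. *)
set m := (alpha 0%N).1.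
exists (- (m.+1%:R *: w)), (m.+1%:R *: w) => _ [T TT_T] [z /abu zu <-].
have [] := bnd 0%N (m, exist _ z zu) T (leqnn _) TT_T.
rewrite /interval_net /= invr1 scale1r linearZ /= => hi lo.
have -> : T z = m.+1%:R *: (m.+1%:R^-1 *: T z).
  by rewrite scalerA divff ?scale1r ?pnatr_eq0.
apply: ov_scale_interval => //; rewrite hi andbT.
by rewrite -[leRHS]opprK; apply: ov_leN2.
Qed.

Lemma order_bounded_ru_continuous :
  generating_cone Y ->
  collectively_order_bounded TT -> collectively_ru_continuous TT.
Proof.
move=> gY bT A leA _ x [u _ [alpha alpha_incr bnd]].
have [c [d TTcd]] := bT (- u) u.
(* The generating cone of [Y] replaces [c, d] by a symmetric interval, whose multiples by 1/(n+1)
   are the intervals required of a regulator. *)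
have [w w0 cdw] := generating_cone_sym_interval gY c d.
(* The index sequence of [x] serves all [T] at once, since [w] bounds the whole of [TT] on
   [-u, u]. *)
exists w => //; exists alpha => // n i T ni TT_T.
have := bnd n i ni; rewrite subr0 => xi.
have nz : n.+1%:R != 0 :> R by rewrite pnatr_eq0.
(* Enlarging [x i] by [n + 1] brings it into the fixed interval [-u, u]; linearity of [T] undoes the
   factor afterwards. *)
have zu : - u <= n.+1%:R *: x i <= u.
  have := ov_scale_interval (ler0n R n.+1) xi.
  by rewrite scalerA divff ?scale1r.
have /cdw Tw : order_interval c d (T (n.+1%:R *: x i)).
  by apply: TTcd; exists T => //; exists (n.+1%:R *: x i).
have inv_ge0 : 0 <= n.+1%:R^-1 :> R by rewrite invr_ge0 ler0n.
have /andP[] := ov_scale_interval inv_ge0 Tw.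
rewrite [T _]linearZ /= scalerA mulVf// scale1r => lo hi; split=> //.
by rewrite -[leRHS]opprK; apply: ov_leN2.
Qed.

End CollectiveBoundedness.

Theorem theorem2p4 (R : realType) (X Y : orderedVectorType R) :
  (generating_cone X ->
     forall TT : set {linear X -> Y},
       collectively_ru_continuous TT -> collectively_order_bounded TT) /\
  (generating_cone Y ->
     forall TT : set {linear X -> Y},
       collectively_order_bounded TT -> collectively_ru_continuous TT).
Proof.
split=> gen TT; first exact: ru_continuous_order_bounded.
exact: order_bounded_ru_continuous.
Qed.
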